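(* Let $m$ be a positive integer, let $f:\mathbb{Z}_{\geq 0}\to\mathbb{Z}_{\geq 0}$ be an increasing function and let $a,d\in\mathbb{Z}_{\geq 0}$ be such that $$a\cdot f(i+1)\geq (a+1)f(i)\quad\text{for all } i>0.$$ If $$(a+1)f(i+1)\leq A(d,\,a\cdot f(i)-1)\quad\text{for all } i>0,$$ then $$l_{f,m} < \big\lceil f^{-1}\big(A(m+d,(a+1)f(1)-1)/a\big)\big\rceil.$$
   Context: The Ackermann function $A:\mathbb{Z}_{\geq 0}\times\mathbb{Z}_{\geq 0}\to\mathbb{Z}_{\geq 0}$ is defined by $A(0,n)=n+1$, $A(m+1,0)=A(m,1)$, $A(m+1,n+1)=A(m,A(m+1,n))$ for $m,n\geq 0$. The expressions $A(\cdot,\cdot)$ in the hypotheses and conclusion are understood to be defined, i.e. their arguments are nonnegative integers (in particular $a\cdot f(i)-1\ge 0$ for $i>0$). ''Increasing'' means $f(i)\leq f(j)$ whenever $i\leq j$. For real $x$, $\lceil f^{-1}(x)\rceil$ denotes the least nonnegative integer $k$ such that $f(k)\geq x$. A sequence $\tau_1,\dots,\tau_k$ of $m$-tuples of nonnegative integers is Dicksonian if $\tau_i\nleq\tau_j$ for all $i<j$, where $\leq$ is the product (coordinatewise) order on $\mathbb{Z}_{\geq 0}^m$. Writing $\tau_i=(\tau_1^i,\dots,\tau_m^i)$, the degree growth of the sequence is bounded by $f$ if $\deg\tau_i:=\tau_1^i+\cdots+\tau_m^i\leq f(i)$ for all $1\leq i\leq k$. $l_{f,m}$ denotes the maximal length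 of a Dicksonian sequence of $m$-tuples of nonnegative integers whose degree growth is bounded by $f$. *)

(* Defs.v *)
From mathcomp Require Import all_boot all_order all_algebra.
Set Implicit Arguments.
Unset Strict Implicit.
Unset Printing Implicit Defensive.
Import Order.TTheory GRing.Theory Num.Theory.

Fixpoint ackermann (m n : nat) {struct m} : nat :=
  match m with
  | 0 => n.+1
  | m'.+1 =>
    (fix ackermannSm (n : nat) : nat :=
       match n with
       | 0 => ackermann m' 1
       | n'.+1 => ackermann m' (ackermannSm n')
       end) n
  end.

Lemma ackermann0n n : ackermann 0 n = n.+1.
Proof. by []. Qed.

Lemma ackermannSn0 m : ackermann m.+1 0 = ackermann m 1.
Proof. by []. Qed.

Lemma ackermannSS m n :
  ackermann m.+1 n.+1 = ackermann m (ackermann m.+1 n).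
Proof. by []. Qed.

(* [m.-tupleprod nat] is [m.-tuple nat] carrying the product order. *)
Definition dicksonian (m : nat) (s : seq (m.-tupleprod nat)) : bool :=
  pairwise (fun x y => ~~ (x <= y)%O) s.

Lemma tupleprod_leE (m : nat) (x y : m.-tupleprod nat) :
  (x <= y)%O = [forall i, tnth x i <= tnth y i].
Proof. by rewrite leEtprod. Qed.

Definition tdeg (m : nat) (t : m.-tuple nat) : nat := \sum_(i < m) tnth t i.

(* Sequences are numbered from 1 in the mathematics and from 0 here, hence
   the shift in the argument of [f]. *)
Definition degree_growth_bounded (f : nat -> nat) (m : nat)
    (s : seq (m.-tupleprod nat)) : Prop :=
  forall i : 'I_(size s), tdeg (tnth (in_tuple s) i) <= f i.+1.

(* [l] is l_{f,m}; a relation rather than a function, so that the existence of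
   the maximum is asserted wherever l_{f,m} is used. *)
Definition max_dicksonian_length (f : nat -> nat) (m l : nat) : Prop :=
  (exists s : seq (m.-tupleprod nat),
     [/\ dicksonian s, degree_growth_bounded f s & size s = l]) /\
  (forall s : seq (m.-tupleprod nat),
     dicksonian s -> degree_growth_bounded f s -> size s <= l).

(* [k] is the ceiling of f^{-1}(x). *)
Definition ceil_inverse (R : realFieldType) (f : nat -> nat) (x : R)
    (k : nat) : Prop :=
  (x <= (f k)%:R)%R /\ (forall j : nat, (x <= (f j)%:R)%R -> k <= j).

(* Main.v *)
Require Import Defs.
From mathcomp Require Import all_boot all_order all_algebra.
From mathcomp Require Import boolp zify.
Set Implicit Arguments.
Unset Strict Implicit.
Unset Printing Implicit Defensive.
Import Order.TTheory GRing.Theory Num.Theory.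

(** Write [A] for the Ackermann function and [q i] for [(a + 1) * f i - 1]. The
    tuples that may follow [tau_1, ..., tau_i] are those above none of these.
    They are covered by finitely many coordinate flats, obtained by prescribing
    some coordinates and leaving the others free; at the beginning the whole
    space, a flat of dimension [m], is needed. The next tuple [t] lies in some
    flat of the cover, and a later tuple in the same flat must have a free
    coordinate strictly below that of [t]. So this flat can be replaced by at
    most [tdeg t], hence at most [f i], flats of one dimension less, one for each
    free coordinate [j] and each value below [t_j] ([split_flatP],
    [size_split_flat]).

    Only the number [n_r] of flats of each dimension [r] is remembered. The
    potential
      [A(m+d, -)^n_m ( ... (A(1+d, -)^n_1 (A(d, -)^n_0 (q i))))]
    does not increase from one tuple to the next ([sweep_step0],
    [sweep_stepS]). The point is that [q i = (a * f i - 1) + f i], that the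
    hypothesis on [f] bounds [q i.+1] by [A(d, a * f i - 1)], and that the
    remaining [f i] units in the argument of [A(r+1+d, -)] amount to [f i] more
    applications of [A(r+d, -)], which pay for the new flats. Flats of smaller
    dimension that are still in the cover do no harm, as two Ackermann functions
    give the larger value when the slower one is applied first
    ([ackermann_swap]).

    The potential starts at [A(m+d, q 1)] and is at least [q i] throughout, so a
    sequence of length [n] satisfies [q n.+1 <= A(m+d, q 1)]
    ([dicksonian_start]). Since [f] is strictly increasing from [1] on, this
    gives [a * f n < A(m+d, q 1)], which bounds the lengths and says that [n]
    lies below the least [k] with [A(m+d, q 1) / a <= f k]. *)

Local Arguments ackermann : simpl never.

(** * The Ackermann function *)

Lemma ltn_ackermannr m n : n < ackermann m n.
Proof.
elim: m n => [|m IHm] n; first by rewrite ackermann0n.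
elim: n => [|n IHn]; first by rewrite ackermannSn0 (ltn_trans _ (IHm 1)).
by rewrite ackermannSS (leq_ltn_trans IHn) ?IHm.
Qed.

Lemma ltn_ackermannS m n : ackermann m n < ackermann m n.+1.
Proof.
by case: m => [|m]; rewrite ?ackermann0n // ackermannSS ltn_ackermannr.
Qed.

Lemma leq_ackermann2l m : {homo ackermann m : x y / x <= y}.
Proof.
by apply: homo_leq leqnn leq_trans _ => n; apply: ltnW (ltn_ackermannS m n).
Qed.

Lemma ackermann_superadd m n e : ackermann m n + e <= ackermann m (n + e).
Proof.
elim: e => [|e IHe]; first by rewrite !addn0.
by rewrite !addnS (leq_ltn_trans IHe) ?ltn_ackermannS.
Qed.

Lemma leq_ackermannSl m n : ackermann m n <= ackermann m.+1 n.
Proof.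
case: n => [|n]; first by rewrite ackermannSn0 leq_ackermann2l.
by rewrite ackermannSS leq_ackermann2l ?ltn_ackermannr.
Qed.

Lemma leq_ackermann2r n : {homo ackermann^~ n : p q / p <= q}.
Proof. by apply: homo_leq leqnn leq_trans _ => p; apply: leq_ackermannSl. Qed.

Lemma ackermann_iter m n e :
  ackermann m.+1 (n + e) = iter e (ackermann m) (ackermann m.+1 n).
Proof.
by elim: e => [|e IHe]; rewrite ?addn0 // addnS ackermannSS IHe.
Qed.

(** Of two Ackermann functions, applying the slower one first gives the larger
    value: that first application already adds one to the argument of the
    faster function, which is worth an application of the next slower level
    outside. *)
Lemma ackermann_swap p q n :
  p < q -> ackermann p (ackermann q n) <= ackermann q (ackermann p n).
Proof.
case: q => // q le_pq.
apply: leq_trans (leq_ackermann2l q.+1 (ltn_ackermannr p n)).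
by rewrite ackermannSS leq_ackermann2r.
Qed.

(** * The potential *)

Section Sweep.

Variable d : nat.

Implicit Types cnt : nat -> nat.

(** The potential at argument [x] of a cover with [cnt r] flats of dimension [r]
    for each [r < k]. The flats of small dimension act first because this order
    gives the largest value. *)
Fixpoint sweep cnt k x :=
  if k is r.+1 then iter (cnt r) (ackermann (r + d)) (sweep cnt r x) else x.

Lemma leq_iter_ackermann m n x : x + n <= iter n (ackermann m) x.
Proof.
elim: n => [|n IHn]; first by rewrite addn0.
by rewrite addnS (leq_ltn_trans IHn) ?ltn_ackermannr.
Qed.

Lemma leq_iter_ackermann2 m n n' x x' : n <= n' -> x <= x' ->
  iter n (ackermann m) x <= iter n' (ackermann m) x'.
Proof.
move=> /subnK <- le_x; rewrite addnC iterD.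
elim: n (n' - n) => [|n IHn] e; last by rewrite !iterS; apply: leq_ackermann2l.
apply: leq_trans (leq_iter_ackermann m e x').
exact: leq_trans le_x (leq_addr _ _).
Qed.

Lemma leq_sweep2 cnt cnt' k x x' :
    (forall r, r < k -> cnt r <= cnt' r) -> x <= x' ->
  sweep cnt k x <= sweep cnt' k x'.
Proof.
move=> + le_x; elim: k => //= k IHk le_cnt.
apply: leq_iter_ackermann2; first exact: le_cnt.
by apply: IHk => r lt_rk; apply/le_cnt/ltnW.
Qed.

Lemma leq_sweep_tail cnt cnt' j k x x' :
    j <= k -> (forall r, j <= r -> cnt r <= cnt' r) ->
  sweep cnt j x <= sweep cnt' j x' -> sweep cnt k x <= sweep cnt' k x'.
Proof.
move=> le_jk le_cnt le_j; elim: k le_jk => [|k IHk].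
  by rewrite leqn0 => /eqP j0; rewrite j0 in le_j.
rewrite leq_eqVlt => /predU1P[<- //|]; rewrite ltnS => le_jk /=.
by apply: leq_iter_ackermann2; [apply: le_cnt | apply: IHk].
Qed.

Lemma leq_sweep cnt k x : x <= sweep cnt k x.
Proof.
elim: k => //= k IHk.
apply: leq_trans (leq_iter_ackermann _ _ _).
exact: leq_trans IHk (leq_addr _ _).
Qed.

Lemma sweep_superadd cnt k x e : sweep cnt k x + e <= sweep cnt k (x + e).
Proof.
elim: k => //= k IHk; set g := ackermann _.
elim: (cnt k) => //= n IHn.
exact: leq_trans (ackermann_superadd _ _ _) (leq_ackermann2l _ IHn).
Qed.

Lemma sweep_swap cnt k q x : k <= q ->
  sweep cnt k (ackermann (q + d) x) <= ackermann (q + d) (sweep cnt k x).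
Proof.
elim: k => //= k IHk lt_kq; elim: (cnt k) => [|n IHn]; first exact/IHk/ltnW.
apply: leq_trans (leq_ackermann2l _ IHn) _.
by apply: ackermann_swap; rewrite ltn_add2r.
Qed.

(** A flat of dimension [0] is a point, so nothing replaces it: its own
    application of level [d], the innermost one, accounts for the change of
    argument. *)
Lemma sweep_step0 cnt cnt' k x x' :
    0 < k -> cnt' 0 < cnt 0 -> (forall r, cnt' r <= cnt r) ->
  x' <= ackermann d x -> sweep cnt' k x' <= sweep cnt k x.
Proof.
move=> k_gt0 lt_cnt0 le_cnt le_x'.
apply: leq_sweep_tail k_gt0 _ _ => // /=.
apply: leq_trans (leq_iter_ackermann2 _ lt_cnt0 (leqnn x)).
by rewrite iterSr leq_iter_ackermann2.
Qed.

(** Spending a flat of dimension [s + 1] for at most [e] flats of dimension [s]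
    does not raise the potential, even though flats of smaller dimension are
    left over. Indeed the recursion of the Ackermann function turns [e] more
    units in the argument of level [s + 1] into [e] more applications of level
    [s]. Superadditivity carries these units out of the applications that stand
    for the flats of smaller dimension, and the latter applications may be moved
    outside that of level [s + 1], which then takes the place of the
    application of level [d] in the bound on [x']. *)
Lemma sweep_stepS cnt cnt' k s y e x' :
    s.+1 < k -> cnt' s.+1 < cnt s.+1 -> cnt' s <= cnt s + e ->
    (forall r : nat, r != s -> cnt' r <= cnt r) ->
  x' <= ackermann d y -> sweep cnt' k x' <= sweep cnt k (y + e).
Proof.
move=> lt_sk lt_cntS le_cnts le_cnt le_x'.
apply: (leq_sweep_tail lt_sk) => [r lt_sr|/=]; first by apply: le_cnt; lia.
apply: leq_trans (leq_iter_ackermann2 _ lt_cntS (leqnn _)).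
rewrite iterSr; apply: leq_iter_ackermann2 => //.
(* The [e + cnt s] units split off here become applications of level [s] on the
   way down to the left-hand side. *)
apply: (@leq_trans
  (ackermann (s.+1 + d) (sweep cnt s y + (e + cnt s)))); last first.
  apply: leq_ackermann2l; rewrite addnA.
  apply: leq_trans (leq_iter_ackermann _ _ _).
  by rewrite leq_add2r sweep_superadd.
rewrite addSn ackermann_iter; apply: leq_iter_ackermann2.
  by rewrite addnC.
rewrite -addSn; apply: leq_trans (sweep_swap cnt y (leqnSn s)).
apply: leq_sweep2 => [r lt_rs|]; first by apply: le_cnt; lia.
by apply: leq_trans le_x' _; rewrite leq_ackermann2r ?leq_addl.
Qed.

End Sweep.

(** * Covering the tuples that may still occur *)

Section Flats.

Variable m : nat.

(** [None] marks the free coordinates. They carry no lower bound, as only the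
    number and the dimension of the flats matter. *)
Definition flat := {ffun 'I_m -> option nat}.

Implicit Types (c : flat) (S : seq flat) (t w : m.-tupleprod nat).

Definition in_flat c w := [forall j, (c j == None) || (c j == Some (tnth w j))].

Definition flat_dim c := #|[pred j | c j == None]|.

Definition fix_coord c j v : flat := [ffun i => if i == j then Some v else c i].

Definition covers S w := has (in_flat^~ w) S.

Definition split_flat c t : seq flat :=
  flatten [seq [seq fix_coord c j v | v <- iota 0 (tnth t j)]
          | j <- enum [pred j | c j == None]].

Lemma mem_split_flat c t c' :
  reflect (exists j v, [/\ c j = None, v < tnth t j & c' = fix_coord c j v])
          (c' \in split_flat c t).
Proof.
apply: (iffP flatten_mapP) => [[j]|[j [v [cj lt_v ->]]]].
  rewrite mem_enum inE => /eqP cj /mapP[v]; rewrite mem_iota => lt_v ->.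
  by exists j, v.
exists j; first by rewrite mem_enum inE cj.
by apply: map_f; rewrite mem_iota.
Qed.

Lemma size_split_flat c t : size (split_flat c t) <= tdeg t.
Proof.
rewrite size_flatten /shape -map_comp sumnE big_map big_enum /=.
rewrite /tdeg [leqRHS](bigID (fun j => c j == None)) /=.
apply: leq_trans (leq_addr _ _).
by apply: leq_sum => j _; rewrite size_map size_iota.
Qed.

Lemma flat_dim_split c t c' :
  c' \in split_flat c t -> flat_dim c = (flat_dim c').+1.
Proof.
case/mem_split_flat=> j [v [cj _ ->]].
rewrite /flat_dim (cardD1 j) inE cj eqxx add1n; congr _.+1.
by apply: eq_card => i; rewrite !inE ffunE; case: (i == j).
Qed.

(** A tuple of the flat that is not above [t] is smaller than [t] in some
    coordinate, necessarily a free one because [t] lies in the flat too. *)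
Lemma split_flatP c t w :
    in_flat c t -> in_flat c w -> ~~ (t <= w)%O -> covers (split_flat c t) w.
Proof.
move=> /forallP ct /forallP cw; rewrite tupleprod_leE negb_forall.
case/existsP=> j; rewrite -ltnNge => lt_j.
have cj : c j = None.
  case/orP: (ct j) => [/eqP //|/eqP cjt].
  case/orP: (cw j); rewrite cjt // => /eqP[eq_tw].
  by rewrite eq_tw ltnn in lt_j.
apply/hasP; exists (fix_coord c j (tnth w j)).
  by apply/mem_split_flat; exists j, (tnth w j).
apply/forallP=> i; rewrite ffunE; case: (i =P j) => [->|_]; last exact: cw.
by rewrite eqxx orbT.
Qed.

Lemma covers_split S c t w : c \in S -> in_flat c t -> covers S w ->
  ~~ (t <= w)%O -> covers (rem c S ++ split_flat c t) w.
Proof.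
move=> cS ct + not_le; rewrite /covers has_cat.
rewrite (eq_has_r (perm_mem (perm_to_rem cS))) /=.
case/orP=> [cw|->//]; apply/orP; right; exact: split_flatP not_le.
Qed.

Definition dim_count S r := count (fun c => flat_dim c == r) S.

Lemma dim_count_split S c t r : c \in S ->
  dim_count (rem c S ++ split_flat c t) r + (flat_dim c == r)
    = dim_count S r
      + (if flat_dim c == r.+1 then size (split_flat c t) else 0).
Proof.
move=> cS; rewrite /dim_count count_cat.
rewrite (permP (perm_to_rem cS)) /= addnAC [_ + (_ == _)]addnC; congr (_ + _).
have dimE c' : c' \in split_flat c t ->
    (flat_dim c' == r) = (flat_dim c == r.+1).
  by move/flat_dim_split->; rewrite eqSS.
rewrite (eq_in_count dimE); case: ifP => _.
  by rewrite (eq_count (a2 := predT)) ?count_predT.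
by rewrite (eq_count (a2 := pred0)) ?count_pred0.
Qed.

End Flats.

(** * The potential along a Dicksonian sequence *)

Section Bound.

Variables (f : nat -> nat) (a d m : nat).
Hypothesis af_gt0 : forall i, 0 < i -> 0 < a * f i.
Hypothesis f_ackermann : forall i, 0 < i ->
  (a + 1) * f i.+1 <= ackermann d (a * f i - 1).

(** The argument of the potential before the [i]-th tuple is chosen. *)
Let start i := (a + 1) * f i - 1.

(** Induction on the sequence: its first tuple replaces one flat of the cover by
    flats of one dimension less, which does not raise the potential, and the
    new flats cover the remaining tuples. *)
Lemma dicksonian_sweep t0 (s : seq (m.-tupleprod nat)) S i : 0 < i ->
    dicksonian s -> all (covers S) s ->
    (forall j, j < size s -> tdeg (nth t0 s j) <= f (i + j)) ->
  start (i + size s) <= sweep d (dim_count S) m.+1 (start i).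
Proof.
elim: s S i => [|t s IHs] S i i_gt0; first by rewrite addn0 leq_sweep.
rewrite /dicksonian /= => /andP[/allP t_s dick_s].
case/andP=> /hasP[c cS ct] /allP S_s deg_s.
set S' := rem c S ++ split_flat c t.
rewrite addnS -addSn.
apply: (@leq_trans (sweep d (dim_count S') m.+1 (start i.+1))).
  apply: IHs => // [|j lt_j]; last by rewrite addSnnS; apply: (deg_s j.+1).
  by apply/allP=> w ws; apply: covers_split; rewrite ?t_s ?S_s.
have cnt r := dim_count_split t r cS.
have le_start : start i.+1 <= ackermann d (a * f i - 1).
  exact: leq_trans (leq_subr _ _) (f_ackermann i_gt0).
(* The summand [f i] is what pays for the new flats. *)
have startE : start i = a * f i - 1 + f i.
  by have := af_gt0 i_gt0; rewrite /start mulnDl mul1n; lia.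
have dim_c : flat_dim c <= m by rewrite -[leqRHS]card_ord max_card.
have size_c : size (split_flat c t) <= f i.
  apply: leq_trans (size_split_flat c t) _.
  by have := deg_s 0 isT; rewrite addn0.
case dimE: (flat_dim c) dim_c => [|r] dim_c.
  apply: sweep_step0 => // [|r|].
  - by have := cnt 0; rewrite dimE /S' /=; lia.
  - by have := cnt r; rewrite dimE /S' /=; lia.
  by apply: leq_trans le_start _; rewrite leq_ackermann2l // startE leq_addr.
rewrite startE; apply: (@sweep_stepS d _ _ _ r) => // [||q q_r].
- by have := cnt r.+1; rewrite dimE eqxx eqn_leq ltnn andbF /S'; lia.
- by have := cnt r; rewrite dimE eqxx /S'; lia.
by have := cnt q; rewrite dimE eqSS [r == q]eq_sym (negPf q_r) /S'; lia.
Qed.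

Lemma dicksonian_start (s : seq (m.-tupleprod nat)) :
    dicksonian s -> degree_growth_bounded f s ->
  start (size s).+1 <= ackermann (m + d) (start 1).
Proof.
move=> dick_s deg_s; pose c : flat m := [ffun => None].
have dim_c : flat_dim c = m.
  by rewrite -[RHS]card_ord; apply: eq_card => j; rewrite !inE ffunE.
have cntE r : dim_count [:: c] r = (m == r).
  by rewrite /dim_count /= dim_c addn0.
have -> : ackermann (m + d) (start 1)
    = sweep d (dim_count [:: c]) m.+1 (start 1).
  move: (dim_count _) cntE => cnt cntE.
  have sweepE k : k <= m -> sweep d cnt k (start 1) = start 1.
    by elim: k => //= k IHk lt_km; rewrite cntE gtn_eqF // IHk // ltnW.
  by rewrite /= cntE eqxx sweepE.
rewrite -add1n; apply: (@dicksonian_sweep (nseq_tuple m 0)) => // [|j lt_j].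
  apply/allP=> w _; rewrite /covers /= orbF.
  by apply/forallP=> j; rewrite ffunE.
by have := deg_s (Ordinal lt_j); rewrite (tnth_nth (nseq_tuple m 0)).
Qed.

End Bound.

(** * The bound on the maximal length *)

Theorem lemma2p6 (R : realFieldType) (m : nat) (f : nat -> nat) (a d : nat)
    (m_gt0 : 0 < m)
    (f_incr : forall i j : nat, i <= j -> f i <= f j)
    (af_gt0 : forall i : nat, 0 < i -> 0 < a * f i)
    (f_growth : forall i : nat, 0 < i -> (a + 1) * f i <= a * f i.+1)
    (f_ackermann : forall i : nat, 0 < i ->
       (a + 1) * f i.+1 <= ackermann d (a * f i - 1)) :
  exists l k : nat,
    [/\ max_dicksonian_length f m l,
        ceil_inverse f
          ((ackermann (m + d) ((a + 1) * f 1%N - 1)%N)%:R / a%:R : R)%R k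
      & l < k].
Proof.
have a_gt0 : 0 < a by have := af_gt0 1 isT; rewrite muln_gt0 => /andP[].
have f_gt0 i : 0 < i -> 0 < f i by move/af_gt0; rewrite muln_gt0 => /andP[].
have f_ge i : i <= f i.
  elim: i => // -[_|i IHi]; first exact: f_gt0.
  have := f_growth i.+1 isT; have := f_gt0 i.+1 isT; nia.
set N := ackermann (m + d) ((a + 1) * f 1 - 1).
have lt_N (s : seq (m.-tupleprod nat)) :
    dicksonian s -> degree_growth_bounded f s -> a * f (size s) < N.
  move=> dick_s deg_s.
  have := dicksonian_start af_gt0 f_ackermann dick_s deg_s; rewrite -/N.
  case: (size s) => [_|n].
    apply: leq_trans (ltn_ackermannr _ _); rewrite ltnS.
    by have := f_incr 0 1 isT; have := f_gt0 1 isT; nia.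
  have := f_growth n.+1 isT; have := f_gt0 n.+1 isT.
  by have := f_gt0 n.+2 isT; nia.
have [l max_l] : exists l, max_dicksonian_length f m l.
  pose P n := `[< exists s : seq (m.-tupleprod nat),
    [/\ dicksonian s, degree_growth_bounded f s & size s = n] >].
  have exP : exists n, P n.
    by exists 0; apply/asboolP; exists [::]; split=> // -[].
  have ubP n : P n -> n <= N.
    move=> /asboolP[s [dick_s deg_s <-]].
    by have := lt_N s dick_s deg_s; have := f_ge (size s); nia.
  have [l /asboolP Pl max_l] := ex_maxnP exP ubP.
  exists l; split=> // s dick_s deg_s.
  by apply: max_l; apply/asboolP; exists s.
have exk : exists k, N <= a * f k by exists N; have := f_ge N; nia.
have [k Nk min_k] := ex_minnP exk.
have leE j : (N%:R / a%:R <= (f j)%:R :> R)%R = (N <= a * f j).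
  by rewrite ler_pdivrMr ?ltr0n // -natrM ler_nat mulnC.
exists l, k; split=> //.
  by split=> [|j]; rewrite leE //; apply: min_k.
have [[s [dick_s deg_s sizeE]] _] := max_l.
have lt_l := lt_N s dick_s deg_s.
rewrite sizeE in lt_l; rewrite ltnNge; apply/negP=> /f_incr le_kl.
by have := leq_mul (leqnn a) le_kl; lia.
Qed.
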